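(* Let $\mathcal{A}$ be a unital C$^*$-algebra and let $a\in G^+$. Then $$\mathcal{U}_a\cap G^s=P(\mathcal{A}_a)=\{u\in P: au=ua\}.$$
   Context: For a unital C$^*$-algebra $\mathcal{B}$ with involution $*$: $G(\mathcal{B})$ is the group of invertible elements, $\mathcal{U}(\mathcal{B})$ the unitary group, $G^+(\mathcal{B})$ the set of positive invertible elements, $G^s(\mathcal{B})$ the set of invertible selfadjoint elements, and $P(\mathcal{B})=\{\rho\in G(\mathcal{B}):\rho=\rho^*=\rho^{-1}\}$ the space of orthogonal reflections. When $\mathcal{B}=\mathcal{A}$ one writes simply $G,\mathcal{U},G^+,G^s,P$. For $a\in G^+$, $\mathcal{U}_a=\{g\in G: a^{-1}g^*a=g^{-1}\}$ is the unitary group for the involution $x^{\#_a}=a^{-1}x^*a$, and $\mathcal{A}_a=\{d\in\mathcal{A}: da=ad\}$ is the relative commutant C$^*$-subalgebra. *)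

(* Defs.v *)
From HB Require Import structures.
From mathcomp Require Import all_boot all_order all_algebra.
From mathcomp Require Import complex.
From mathcomp Require Import boolp classical_sets reals topology normedtype.

Set Implicit Arguments.
Unset Strict Implicit.
Unset Printing Implicit Defensive.

Import Order.TTheory GRing.Theory Num.Theory.
Import numFieldNormedType.Exports.

Local Open Scope classical_set_scope.
Local Open Scope ring_scope.
Local Open Scope complex_scope.

(* [numDomainType] already inherits rings and the norm [`|_|], so no new       *)
(* structure can join the library's rings and normed modules. The norm of an  *)
(* algebra A is therefore a separate operation [anorm], and the library's     *)
(* normed module built from it lives on the copy [nspace A] of A. As for any  *)
(* K-module of the library, norms take values in K. With K := R[i], in whose  *)
(* order [0 <= z] says that z is a nonnegative real, the norm axioms force    *)
(* these values to be nonnegative reals.                                      *)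
HB.mixin Record hasAlgebraNorm (K : numFieldType) A & GRing.UnitAlgebra K A := {
  anorm : A -> K;
  anormD_le : forall x y : A, anorm (x + y) <= anorm x + anorm y;
  anormZ : forall (l : K) (x : A), anorm (l *: x) = `|l| * anorm x;
  anorm0_eq0 : forall x : A, anorm x = 0 -> x = 0;
  anormM_le : forall x y : A, anorm (x * y) <= anorm x * anorm y
}.

#[short(type="normedAlgType")]
HB.structure Definition NormedAlgebra (K : numFieldType) :=
  {A of GRing.UnitAlgebra K A & hasAlgebraNorm K A}.

Definition nspace (K : numFieldType) (A : normedAlgType K) : Type := A.

HB.instance Definition _ (K : numFieldType) (A : normedAlgType K) :=
  GRing.Lmodule.on (nspace A).
HB.instance Definition _ (K : numFieldType) (A : normedAlgType K) :=
  Lmodule_isNormed.Build K (nspace A)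
    anormD_le anormZ anorm0_eq0.

HB.mixin Record isCompleteAlgebra (K : numFieldType) A & NormedAlgebra K A := {
  nspace_complete : forall F : set_system (nspace A),
    ProperFilter F -> cauchy F -> cvg F
}.

#[short(type="banachAlgType")]
HB.structure Definition BanachAlgebra (K : numFieldType) :=
  {A of NormedAlgebra K A & isCompleteAlgebra K A}.

HB.instance Definition _ (K : numFieldType) (A : banachAlgType K) :=
  Uniform_isComplete.Build (nspace A) nspace_complete.

HB.mixin Record hasCStarInvolution (R : realType) A & BanachAlgebra R[i] A := {
  star : A -> A;
  starK : involutive star;
  starD : forall x y : A, star (x + y) = star x + star y;
  starZ : forall (l : R[i]) (x : A), star (l *: x) = Num.conj l *: star x;
  starM : forall x y : A, star (x * y) = star y * star x;
  anorm_starM : forall x : A, anorm (star x * x) = anorm x ^+ 2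
}.

(* Unital C*-algebras. As a [unitRingType], A satisfies 1 != 0, and           *)
(* [x \is a GRing.unit] means that x has a two-sided inverse in A.            *)
#[short(type="cstarAlgType")]
HB.structure Definition CStarAlgebra (R : realType) :=
  {A of BanachAlgebra R[i] A & hasCStarInvolution R A}.

Section Notions.
Context {R : realType} (B : cstarAlgType R).

Definition invertibles : set B := [set x | x \is a GRing.unit].

Definition spectrum (x : B) : set R[i] :=
  [set l | l%:A - x \isn't a GRing.unit].

Definition selfadjoint (x : B) : Prop := star x = x.

Definition positive (x : B) : Prop :=
  selfadjoint x /\ forall l, spectrum x l -> 0 <= l.

Definition pos_invertibles : set B :=
  [set x | invertibles x /\ positive x].

Definition sa_invertibles : set B :=
  [set x | invertibles x /\ selfadjoint x].

Definition reflections : set B :=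
  [set r | invertibles r /\ r = star r /\ star r = r^-1].

Definition unitaries_at (a : B) : set B :=
  [set g | invertibles g /\ a^-1 * star g * a = g^-1].

Definition commutes_with (a : B) : {pred B} := fun d => d * a == a * d.

End Notions.

Arguments invertibles {R} B _.
Arguments pos_invertibles {R} B _.
Arguments sa_invertibles {R} B _.
Arguments reflections {R} B _.

Section CommutantClosed.
Context {R : realType} {A : cstarAlgType R} (a : A).

Lemma commutes_withP d : reflect (d * a = a * d) (d \in commutes_with a).
Proof. exact: eqP. Qed.

Fact commutes_with_divalg : divalg_closed (commutes_with a).
Proof.
split=> [|l x y /commutes_withP cx /commutes_withP cy|
          x y /commutes_withP cx /commutes_withP cy]; apply/commutes_withP.
- by rewrite mul1r mulr1.
- by rewrite mulrDl mulrDr -scalerAl -scalerAr cx cy.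
- rewrite -mulrA (_ : y^-1 * a = a * y^-1) ?mulrA ?cx //.
  exact/esym/(@commrV _ a y)/esym.
Qed.

Lemma star_commutes d :
  selfadjoint a -> d \in commutes_with a -> star d \in commutes_with a.
Proof.
move=> sa /commutes_withP cd; apply/commutes_withP.
by rewrite -[in LHS]sa -[in RHS]sa -!starM cd.
Qed.

HB.instance Definition _ :=
  GRing.isDivalgClosed.Build R[i] A (commutes_with a) commutes_with_divalg.

End CommutantClosed.

(* The relative commutant of a. The proof [ha] is a parameter because the     *)
(* commutant is stable under the involution only for suitable a.              *)
Record commutant (R : realType) (A : cstarAlgType R) (a : A)
    (ha : pos_invertibles A a) := Commutant {
  commutant_val : A;
  _ : commutant_val \in commutes_with a
}.

Section CommutantCStar.
Context (R : realType) (A : cstarAlgType R) (a : A) (ha : pos_invertibles A a).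

Local Notation Aa := (commutant ha).

HB.instance Definition _ := [isSub for @commutant_val R A a ha].
HB.instance Definition _ := [Choice of Aa by <:].
HB.instance Definition _ := [SubChoice_isSubAlgebra of Aa by <:].
HB.instance Definition _ := [SubNzRing_isSubUnitRing of Aa by <:].

Definition commutant_norm (x : Aa) : R[i] := anorm (val x).

Fact commutant_norm0_eq0 x : commutant_norm x = 0 -> x = 0.
Proof. by move=> /anorm0_eq0 x0; exact: val_inj. Qed.

HB.instance Definition _ := @hasAlgebraNorm.Build R[i] Aa commutant_norm
  (fun x y => anormD_le (val x) (val y)) (fun l x => anormZ l (val x))
  commutant_norm0_eq0 (fun x y => anormM_le (val x) (val y)).

Let inc (x : nspace Aa) : nspace A := val (x : Aa).

Let limit_commutes (F : set_system (nspace Aa)) (l : nspace A) :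
  ProperFilter F -> inc @ F --> l -> (l : A) \in commutes_with a.
Proof.
move=> FF /cvgrPdist_lt Fl; apply/commutes_withP/eqP; rewrite -subr_eq0.
set d : A := _ - _; apply/negPn/negP => d0.
have m0 : 0 < `|d : nspace A| by rewrite normr_gt0.
pose c := `|a : nspace A|; have c0 : 0 <= c by exact: normr_ge0.
have k0 : 0 < c *+ 2 + 1 by rewrite ltr_wpDl// mulrn_wge0.
have [x lx] := filter_ex (Fl _ (divr_gt0 m0 k0)).
pose y : A := (l : A) - val (x : Aa).
have dE : d = y * a - a * y.
  have /commutes_withP xa := valP (x : Aa).
  by rewrite /y mulrBl mulrBr xa opprB addrA subrK.
suff : `|d : nspace A| < `|d : nspace A| by rewrite ltxx.
have yc : `|d : nspace A| <= `|y : nspace A| * (c *+ 2).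
  rewrite {1}dE (le_trans (ler_normB (y * a : nspace A) (a * y : nspace A)))//.
  rewrite mulrnAr mulr2n lerD//; first exact: anormM_le.
  by rewrite mulrC; exact: anormM_le.
have e0 : 0 < `|d : nspace A| / (c *+ 2 + 1) by exact: divr_gt0.
rewrite (le_lt_trans yc)//.
rewrite (@le_lt_trans _ _ (`|d : nspace A| / (c *+ 2 + 1) * (c *+ 2)))//.
  by rewrite ler_wpM2r ?mulrn_wge0// ltW.
by rewrite -[ltRHS](divfK (lt0r_neq0 k0)) ltr_pM2l// ltrDl.
Qed.

Fact commutant_complete (F : set_system (nspace Aa)) :
  ProperFilter F -> cauchy F -> cvg F.
Proof.
move=> FF /(cauchyP F) Fc.
have Gc : cauchy (inc @ F).
  apply/(cauchyP (inc @ F)) => e e0; have [x Fx] := Fc e e0.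
  exists (inc x); change (F (inc @^-1` ball (inc x) e)).
  apply: filterS Fx => y; by rewrite -!ball_normE.
have [l Gl] := iffLR (cvg_ex (inc @ F)) (cauchy_cvg (inc @ F) Gc).
have la := limit_commutes FF Gl.
apply: (iffRL (cvg_ex F)); exists (Commutant ha la : nspace Aa).
apply/(@cvgrPdist_lt _ _ _ _ _ id) => e e0.
by move/cvgrPdist_lt: Gl => /(_ e e0).
Qed.

HB.instance Definition _ := isCompleteAlgebra.Build R[i] Aa commutant_complete.

Fact star_commutant_subproof (x : Aa) : star (val x) \in commutes_with a.
Proof. by case: ha => _ [sa _]; apply: (star_commutes sa); exact: valP. Qed.

Definition commutant_star (x : Aa) : Aa :=
  Commutant ha (star_commutant_subproof x).

Fact commutant_starK : involutive commutant_star.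
Proof. by move=> x; apply: val_inj => /=; rewrite starK. Qed.
Fact commutant_starD x y :
  commutant_star (x + y) = commutant_star x + commutant_star y.
Proof. by apply: val_inj => /=; rewrite starD. Qed.
Fact commutant_starZ (l : R[i]) x :
  commutant_star (l *: x) = Num.conj l *: commutant_star x.
Proof. by apply: val_inj => /=; rewrite starZ. Qed.
Fact commutant_starM x y :
  commutant_star (x * y) = commutant_star y * commutant_star x.
Proof. by apply: val_inj => /=; rewrite starM. Qed.
Fact commutant_norm_starM x :
  anorm (commutant_star x * x) = anorm x ^+ 2.
Proof. exact: anorm_starM. Qed.

HB.instance Definition _ := @hasCStarInvolution.Build R Aa commutant_star
  commutant_starK commutant_starD commutant_starZ commutant_starM
  commutant_norm_starM.

End CommutantCStar.

(* Main.v *)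
Require Import Defs.
From HB Require Import structures.
From mathcomp Require Import all_boot all_order all_algebra.
From mathcomp Require Import complex.
From mathcomp Require Import boolp classical_sets reals topology normedtype.
From mathcomp Require Import sequences ring lra.

Set Implicit Arguments.
Unset Strict Implicit.
Unset Printing Implicit Defensive.

Import Order.TTheory GRing.Theory Num.Theory.
Import numFieldNormedType.Exports.

Local Open Scope classical_set_scope.
Local Open Scope ring_scope.

(** Let g be selfadjoint and unitary for the involution twisted by a, which
    amounts to g * a * g = a. If a = c * c with c selfadjoint, then
    w = c * g * c^-1 is unitary in the ordinary sense: g is similar to a
    unitary. A selfadjoint element has the least norm in its similarity class
    ([rnorm_le_of_conjugate]), so neither g nor g^-1 has norm larger than 1, and
    this forces g * g = 1 ([involution_of_contractions]). The relation
    g * a * g = a then says that g commutes with a. The remaining inclusions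
    are direct: a reflection is a selfadjoint square root of 1, in A as in the
    commutant of a.

    Two facts of spectral theory are behind this: a positive invertible
    element has a selfadjoint square root ([pos_invertible_sqrt]), and the norm
    of a selfadjoint element is, up to sign, a point of its spectrum
    ([rnorm_in_spectrum]). They are proved without holomorphic functions and
    without functional calculus. The only analysis is a contraction principle,
    which yields the inverse of 1 - x for x of norm less than 1 and the square
    root of 1 - h for h selfadjoint of norm less than 1. The rest is algebra
    with the C*-identity. Commuting selfadjoint p, q with p^2 + q^2 = t satisfy
    |p|^2 <= t, because |p + iq|^2 = t. This gives the quantitative estimate
    used twice below ([rnorm_le_of_inverse]): on the circle x^2 + y^2 = 1, a
    bound |x^-1| < M keeps y away from the unit sphere, |y|^2 <= 1 - 1/M^2.
    With y close to a selfadjoint element of norm 1, it shows that the norm is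
    reached in the spectrum; with x close to g, it shows that g * g = 1. *)

(** * The norm and the involution *)

Section CStarTheory.
Context {R : realType} {A : cstarAlgType R}.
Local Open Scope complex_scope.
Implicit Types (x y g : A) (t r : R).

(** The norm axioms make the values of the norm real; taking them in R gives
    access to total order, square roots and decision procedures. *)
Definition rnorm x : R := complex.Re (anorm x).

Lemma rnormE x : (rnorm x)%:C = anorm x.
Proof. by apply: RRe_real; exact: (@normr_real _ (nspace A) (x : nspace A)). Qed.

Lemma rnorm_ge0 x : 0 <= rnorm x.
Proof. by rewrite -ler0c rnormE; exact: (@normr_ge0 _ (nspace A) x). Qed.

Lemma rnormD x y : rnorm (x + y) <= rnorm x + rnorm y.
Proof. by rewrite -lecR rmorphD/= !rnormE anormD_le. Qed.

Lemma rnormM x y : rnorm (x * y) <= rnorm x * rnorm y.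
Proof. by rewrite -lecR rmorphM/= !rnormE anormM_le. Qed.

Lemma rnormZ t x : rnorm (t%:C *: x) = `|t| * rnorm x.
Proof.
apply: complexI; rewrite rmorphM/= !rnormE anormZ; congr (_ * _).
by rewrite normc_def/= expr0n addr0 sqrtr_sqr.
Qed.

Lemma rnormN x : rnorm (- x) = rnorm x.
Proof. by apply: complexI; rewrite !rnormE; exact: (@normrN _ (nspace A) x). Qed.

Lemma rnormB x y : rnorm (x - y) <= rnorm x + rnorm y.
Proof. by rewrite -(rnormN y) rnormD. Qed.

Lemma rnormBC x y : rnorm (x - y) = rnorm (y - x).
Proof. by rewrite -rnormN opprB. Qed.

Lemma rnorm_eq0 x : rnorm x = 0 -> x = 0.
Proof. by move=> x0; apply: anorm0_eq0; rewrite -rnormE x0. Qed.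

Lemma rnorm0 : rnorm 0 = 0.
Proof. by apply: complexI; rewrite rnormE; exact: (@normr0 _ (nspace A)). Qed.

Lemma rnorm_gt0 x : (0 < rnorm x) = (x != 0).
Proof.
rewrite lt_neqAle rnorm_ge0 andbT eq_sym; congr negb.
by apply/eqP/eqP => [/rnorm_eq0|->]; rewrite ?rnorm0.
Qed.

Lemma rnorm_starM x : rnorm (star x * x) = rnorm x ^+ 2.
Proof. by apply: complexI; rewrite rmorphXn/= !rnormE anorm_starM. Qed.

Lemma rnorm_star x : rnorm (star x) = rnorm x.
Proof.
have le y : rnorm y <= rnorm (star y).
  have [->|y0] := eqVneq y 0; first by rewrite rnorm0 rnorm_ge0.
  by rewrite -(@ler_pM2r _ (rnorm y)) ?rnorm_gt0// -expr2 -rnorm_starM rnormM.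
by apply/le_anti; rewrite le andbT (le_trans (le _))// starK.
Qed.

Lemma rnorm_sq x : selfadjoint x -> rnorm (x * x) = rnorm x ^+ 2.
Proof. by move=> sx; rewrite -rnorm_starM sx. Qed.

Lemma star1 : star (1 : A) = 1.
Proof. by have := starM 1 (star (1 : A)); rewrite mul1r !starK mul1r. Qed.

Lemma rnorm1 : rnorm 1 = 1.
Proof.
have /eqP := rnorm_starM 1; rewrite star1 mul1r expr2 eq_sym -subr_eq0.
rewrite -{3}[rnorm 1]mulr1 -mulrBr mulf_eq0 subr_eq0 => /orP[/eqP/rnorm_eq0/eqP|/eqP//].
by rewrite oner_eq0.
Qed.

Lemma rnorm_scalar t : rnorm (t%:C%:A) = `|t|.
Proof. by rewrite rnormZ rnorm1 mulr1. Qed.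

Lemma starN x : star (- x) = - star x.
Proof. by rewrite -scaleN1r starZ rmorphN1 scaleN1r. Qed.

Lemma starB x y : star (x - y) = star x - star y.
Proof. by rewrite starD starN. Qed.

Lemma starZr t x : star (t%:C *: x) = t%:C *: star x.
Proof. by rewrite starZ conj_Creal// complex_real. Qed.

Lemma selfadjointZ t x : selfadjoint x -> selfadjoint (t%:C *: x).
Proof. by rewrite /selfadjoint starZr => ->. Qed.

Lemma selfadjointB x y : selfadjoint x -> selfadjoint y -> selfadjoint (x - y).
Proof. by rewrite /selfadjoint starB => -> ->. Qed.

Lemma selfadjointM x y : selfadjoint x -> selfadjoint y ->
  GRing.comm x y -> selfadjoint (x * y).
Proof. by rewrite /selfadjoint starM => -> ->. Qed.

Lemma selfadjoint_scalar t : selfadjoint (t%:C%:A : A).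
Proof. exact/selfadjointZ/star1. Qed.

Lemma starV x : x \is a GRing.unit -> star x^-1 = (star x)^-1.
Proof.
move=> ux; have uV : star x^-1 * star x = 1 by rewrite -starM divrr// star1.
have Vu : star x * star x^-1 = 1 by rewrite -starM mulVr// star1.
have us : star x \is a GRing.unit by apply/unitrP; exists (star x^-1).
by rewrite -[RHS]mul1r -uV mulrK.
Qed.

Lemma selfadjointV x : x \is a GRing.unit -> selfadjoint x -> selfadjoint x^-1.
Proof. by move=> ux sx; rewrite /selfadjoint starV// sx. Qed.

(** * Contractions, inverses and square roots *)

Lemma rnorm_complete (u : nat -> A) :
  (forall e, 0 < e -> exists N, forall n m, (N <= n)%N -> (N <= m)%N ->
     rnorm (u n - u m) < e) ->
  exists l, forall e, 0 < e -> exists N, forall n, (N <= n)%N ->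
     rnorm (u n - l) < e.
Proof.
move=> cu; pose v : nat -> nspace A := u.
have cF : cauchy (v @ \oo).
  apply/cauchyP => e e0.
  have eR : (complex.Re e)%:C = e by rewrite RRe_real// gtr0_real.
  have [|N cN] := cu (complex.Re e); first by rewrite -ltcR eR.
  exists (v N); exists N => // n /= Nn; rewrite -ball_normE/=.
  by rewrite -eR -[`|_|](rnormE (u N - u n)) ltcR cN.
have [l /cvgrPdist_lt vl] := iffLR (cvg_ex _) (cauchy_cvg (v @ \oo) cF).
exists l => e e0; have [|N _ cN] := vl e%:C; first by rewrite ltcR.
exists N => n /cN /=; rewrite -[`|_|](rnormE ((l : A) - u n)) ltcR.
by rewrite rnormBC.
Qed.

(** The distances from the n-th iterate are bounded by the tail of a geometric
    series. The hypotheses are restricted to a ball because the map that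
    produces square roots does not contract distances on all of A. *)
Lemma contraction_fixpoint (f : A -> A) (q r : R) : 0 <= q < 1 -> 0 <= r ->
  (forall x, rnorm x <= r -> rnorm (f x) <= r) ->
  (forall x y, rnorm x <= r -> rnorm y <= r ->
     rnorm (f x - f y) <= q * rnorm (x - y)) ->
  exists2 v, rnorm v <= r & f v = v.
Proof.
move=> /andP[q0 q1] r0 fr fq; pose u n := iter n f 0.
have ur n : rnorm (u n) <= r by elim: n => [|n IH]; rewrite /= ?rnorm0 ?fr.
have q1' : 0 < 1 - q by rewrite subr_gt0.
pose D := rnorm (u 1%N - u 0%N).
have step n : rnorm (u n.+1 - u n) <= q ^+ n * D.
  elim: n => [|n IH]; first by rewrite expr0 mul1r.
  by rewrite exprS -mulrA (le_trans (fq _ _ (ur n.+1) (ur n)))// ler_wpM2l.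
have tail n k : rnorm (u (n + k)%N - u n) * (1 - q) <= q ^+ n * D * (1 - q ^+ k).
  elim: k => [|k IH]; first by rewrite addn0 subrr rnorm0 expr0 subrr mulr0 mul0r.
  have -> : u (n + k.+1)%N - u n = (u (n + k).+1 - u (n + k)%N) + (u (n + k)%N - u n).
    by rewrite addrA subrK addnS.
  rewrite (le_trans (ler_wpM2r (ltW q1') (rnormD _ _)))// mulrDl.
  have := ler_wpM2r (ltW q1') (step (n + k)%N).
  rewrite exprD exprS => sk; rewrite (le_trans (lerD sk IH))//.
  by rewrite le_eqVlt; apply/orP; left; apply/eqP; ring.
have D0 : 0 <= D by exact: rnorm_ge0.
have dist N n : (N <= n)%N -> rnorm (u n - u N) <= q ^+ N * (D / (1 - q)).
  move=> Nn; rewrite -(subnKC Nn) mulrA ler_pdivlMr//.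
  rewrite (le_trans (tail _ _))// ler_piMr ?mulr_ge0 ?exprn_ge0//.
  by rewrite gerBl exprn_ge0.
have [e e0|l ul] := @rnorm_complete u.
  have q1n : `|q| < 1 by rewrite ger0_norm.
  have /cvgrPdist_lt/(_ (e / 2)) := cvg_geometric (D / (1 - q)) q1n.
  rewrite divr_gt0// => /(_ isT)[N _ cN]; exists N => n m Nn Nm.
  have := cN N (leqnn N); rewrite /= sub0r normrN ger0_norm; last first.
    by rewrite mulr_ge0 ?exprn_ge0// divr_ge0// ltW.
  rewrite mulrC => lte; have -> : u n - u m = (u n - u N) - (u m - u N).
    by rewrite opprB addrA subrK.
  rewrite (le_lt_trans (rnormB _ _))//; have := dist _ _ Nn; have := dist _ _ Nm.
  lra.
have lr : rnorm l <= r.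
  apply/ler_addgt0Pr => e /ul[N /(_ N (leqnn N)) lN].
  have -> : l = u N - (u N - l) by rewrite opprB addrC subrK.
  by rewrite (le_trans (rnormB _ _))// lerD// ltW.
exists l => //; apply/eqP; rewrite -subr_eq0; apply/eqP/rnorm_eq0/eqP.
rewrite eq_le rnorm_ge0 andbT; apply/ler_addgt0Pr => e e0; rewrite add0r.
have [|N uN] := ul (e / 2); first by rewrite divr_gt0.
have -> : f l - l = (u N.+1 - l) - (f (u N) - f l).
  by rewrite /= opprB [RHS]addrC addrA subrK.
rewrite (le_trans (rnormB _ _))//.
have := uN _ (leqnSn N); have := uN _ (leqnn N); have := fq _ _ (ur N) lr.
have := rnorm_ge0 (u N - l); nra.
Qed.

(** A right inverse of 1 - x is a fixed point of v |-> 1 + x v, and a left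
    inverse one of v |-> 1 + v x. *)
Lemma unit_1B x : rnorm x < 1 -> 1 - x \is a GRing.unit.
Proof.
move=> x1; have x1' : 0 < 1 - rnorm x by rewrite subr_gt0.
pose r := (1 - rnorm x)^-1; have r0 : 0 <= r by rewrite invr_ge0 ltW.
have rE : r = 1 + rnorm x * r.
  by rewrite /r; field; exact: lt0r_neq0.
have x01 : 0 <= rnorm x < 1 by rewrite rnorm_ge0.
have xr y : rnorm y <= r -> 1 + rnorm x * rnorm y <= r.
  by move=> yr; rewrite rE lerD2l ler_wpM2l ?rnorm_ge0.
(* r is the sum of the powers of the norm of x, so this ball is preserved. *)
have [||v _ vE] := @contraction_fixpoint (fun v => 1 + x * v) _ _ x01 r0.
- move=> v vr; rewrite (le_trans (rnormD _ _))// rnorm1 (le_trans _ (xr _ vr))//.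
  by rewrite lerD2l rnormM.
- move=> v w _ _; suff -> : 1 + x * v - (1 + x * w) = x * (v - w) by exact: rnormM.
  by rewrite opprD addrACA subrr add0r mulrBr.
have [||w _ wE] := @contraction_fixpoint (fun v => 1 + v * x) _ _ x01 r0.
- move=> w wr; rewrite (le_trans (rnormD _ _))// rnorm1 (le_trans _ (xr _ wr))//.
  by rewrite lerD2l mulrC rnormM.
- move=> w z _ _; suff -> : 1 + w * x - (1 + z * x) = (w - z) * x.
    by rewrite mulrC; exact: rnormM.
  by rewrite opprD addrACA subrr add0r mulrBl.
have lw : w * (1 - x) = 1 by rewrite mulrBr mulr1 -{1}wE addrK.
have rv : (1 - x) * v = 1 by rewrite mulrBl mul1r -{1}vE addrK.
apply/unitrP; exists v; split => //.
by rewrite -[v]mul1r -lw -mulrA rv mulr1 lw.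
Qed.

Lemma unit_scalarB t x : rnorm x < t -> t%:C%:A - x \is a GRing.unit.
Proof.
move=> xt; have t0 : 0 < t by rewrite (le_lt_trans (rnorm_ge0 x)).
have tu : t%:C \is a GRing.unit by rewrite unitfE eq_complex/= negb_and lt0r_neq0.
have -> : t%:C%:A - x = t%:C *: (1 - (t^-1)%:C *: x).
  by rewrite scalerBr scalerA -rmorphM/= divff ?lt0r_neq0// scale1r.
rewrite scaler_unit// unit_1B// rnormZ gtr0_norm ?invr_gt0// mulrC.
by rewrite ltr_pdivrMr// mul1r.
Qed.

(** Looking for y = 1 - v turns y^2 = 1 - h into v = (h + v^2) / 2, whose right
    side contracts the ball of radius |h| with ratio |h|. The two other
    properties hold because v - v^* and d v - v d, for d commuting with h,
    satisfy d' = (w d' + d' v) / 2 with w = v^* or w = v, and the right side has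
    norm at most |h| |d'|, so that d' = 0. *)
Lemma sqrt_1B h : selfadjoint h -> rnorm h < 1 ->
  exists y : A, [/\ selfadjoint y, y * y = 1 - h &
    forall d, GRing.comm d h -> GRing.comm d y].
Proof.
move=> sh h1; set q := rnorm h.
have q0 : 0 <= q by exact: rnorm_ge0.
have q01 : 0 <= q < 1 by rewrite q0.
pose f v : A := (2^-1)%:C *: (h + v * v).
have half : `|2^-1 : R| = 2^-1 by rewrite ger0_norm// invr_ge0.
have [||v vq vE] := @contraction_fixpoint f q q q01 q0.
- move=> v vq; rewrite rnormZ half.
  have := rnormD h (v * v); have := rnormM v v; have := rnorm_ge0 v.
  rewrite -/q; nra.
- move=> v w vq wq; have -> : f v - f w = (2^-1)%:C *: (v * (v - w) + (v - w) * w).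
    rewrite -scalerBr; congr (_ *: _); rewrite mulrBr mulrBl addrA subrK.
    by rewrite opprD addrACA subrr add0r.
  rewrite rnormZ half; have := rnormD (v * (v - w)) ((v - w) * w).
  have := rnormM v (v - w); have := rnormM (v - w) w; have := rnorm_ge0 (v - w).
  nra.
have vv : h + v * v = v + v.
  rewrite -{3 4}vE /f -scalerDl -rmorphD/=.
  by rewrite (_ : 2^-1 + 2^-1 = 1) ?scale1r//; field.
have vD d : d = (2^-1)%:C *: (v * d + d * v) \/
    d = (2^-1)%:C *: (star v * d + d * v) -> d = 0.
  move=> dE; apply: rnorm_eq0; have sv := rnorm_star v.
  have [w [wv]] : exists w, rnorm w <= q /\ d = (2^-1)%:C *: (w * d + d * v).
    by case: dE => dE; [exists v|exists (star v)]; rewrite ?sv; split.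
  move=> /(congr1 rnorm); rewrite rnormZ half => E.
  have := rnormD (w * d) (d * v); have := rnormM w d; have := rnormM d v.
  have := rnorm_ge0 d; nra.
exists (1 - v); split.
- apply: selfadjointB; first exact: star1.
  apply/eqP; rewrite -subr_eq0; apply/eqP/vD; right.
  rewrite -[in LHS]vE /f starZr starD starM sh -scalerBr; congr (_ *: _).
  rewrite mulrBr mulrBl addrA subrK.
  by rewrite opprD addrACA subrr add0r.
- have -> : h = v + v - v * v by rewrite -vv addrK.
  by rewrite mulrBr mulr1 mulrBl mul1r !opprB -addrA [- v + _]addrCA opprD.
- move=> d dh; suff dv : d * v - v * d = 0.
    by rewrite /GRing.comm mulrBr mulrBl mulr1 mul1r; congr (_ - _); exact/subr0_eq.
  apply: vD; left; rewrite -{1 2}vE /f -scalerAl -scalerAr -scalerBr.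
  congr (_ *: _); rewrite mulrDr mulrDl dh opprD addrACA subrr add0r.
  rewrite mulrBr mulrBl !mulrA [RHS]addrC addrA. by rewrite subrK.
Qed.

(** * Norm estimates from the C*-identity *)

(** The element u = p + iq satisfies u^* u = p^2 + q^2 = t, hence |u|^2 = t, and
    p is its real part. *)
Lemma rnorm_sum_squares (p q : A) t : selfadjoint p -> selfadjoint q ->
  GRing.comm p q -> p * p + q * q = t%:C%:A -> 0 <= t -> rnorm p ^+ 2 <= t.
Proof.
move=> sp sq pq pqt t0; pose u : A := p + 'i%C *: q.
have iC : Num.conj ('i%C : R[i]) = - 'i%C by exact: conjCi.
have ii : 'i%C * 'i%C = -1 :> R[i] by rewrite -expr2 sqr_i.
have su : star u = p - 'i%C *: q by rewrite starD starZ sp sq iC scaleNr.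
have uu : rnorm u ^+ 2 = t.
  rewrite -rnorm_starM -[RHS](ger0_norm t0) -rnorm_scalar -pqt su.
  rewrite /u mulrDr !mulrBl -!scalerAl -!scalerAr scalerA ii scaleN1r opprK pq.
  by rewrite addrA subrK.
have -> : p = (2^-1)%:C *: (u + star u).
  rewrite su /u addrACA subrr addr0 -{2 3}[p]scale1r -scalerDl scalerA.
  suff -> : (2^-1)%:C * (1 + 1) = 1 :> R[i] by rewrite scale1r.
  by rewrite -(rmorph1 (real_complex R)) -rmorphD -rmorphM/=; congr _%:C; field.
suff : rnorm ((2^-1)%:C *: (u + star u)) <= rnorm u.
  by move=> h; rewrite -uu ler_sqr ?nnegrE ?rnorm_ge0.
rewrite rnormZ ger0_norm ?invr_ge0//; have := rnormD u (star u).
rewrite rnorm_star; lra.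
Qed.

(** Put z = x^-1 / M, of norm less than 1, and w^2 = 1 - z^2. Then
    (x w)^2 = x^2 - 1/M^2, so y^2 + (x w)^2 = 1 - 1/M^2 and the preceding lemma
    applies to y and x w. *)
Lemma rnorm_le_of_inverse (x y : A) (M : R) : selfadjoint x -> selfadjoint y ->
  GRing.comm x y -> x * x + y * y = 1 -> x \is a GRing.unit ->
  0 < M -> rnorm x^-1 < M -> rnorm y ^+ 2 <= 1 - M ^- 2.
Proof.
move=> sx sy xy xxyy ux M0 xM; pose z : A := (M^-1)%:C *: x^-1.
have MV0 : 0 < M^-1 by rewrite invr_gt0.
have sz : selfadjoint z by exact/selfadjointZ/selfadjointV.
have z1 : rnorm z < 1 by rewrite rnormZ gtr0_norm// mulrC ltr_pdivrMr// mul1r.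
have [||w [sw ww wc]] := @sqrt_1B (z * z); first exact: selfadjointM.
  by rewrite rnorm_sq// expr_lt1// rnorm_ge0.
have cz d : GRing.comm d x -> GRing.comm d z.
  by move=> /commrV dx; rewrite /GRing.comm -scalerAr -scalerAl dx.
have cw d : GRing.comm d x -> GRing.comm d w.
  by move=> dx; apply/wc/commrM; exact: cz.
have xw := cw x erefl; have yw := cw y (esym xy).
have xwy : GRing.comm y (x * w) by apply: commrM => //; exact: esym.
have M1 : M^-1 <= 1.
  have x1 : rnorm x <= 1.
    by rewrite -(@expr_le1 _ 2) ?rnorm_ge0// (rnorm_sum_squares sx sy xy)// xxyy scale1r.
  rewrite invf_le1//; have := rnormM x x^-1; rewrite divrr// rnorm1.
  have := rnorm_ge0 x; nra.
apply: (rnorm_sum_squares sy (selfadjointM sx sw xw) xwy); last first.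
  rewrite subr_ge0 -exprVn expr_le1// ltW//.
have -> : x * w * (x * w) = x * x - (M ^- 2)%:C%:A.
  rewrite mulrA -[x * w * x]mulrA -xw -!mulrA ww mulrBr mulr1 mulrBr.
  congr (_ - _); rewrite /z -scalerAl -!scalerAr scalerA -rmorphM -invfM -expr2.
  by rewrite mulVKr// divrr.
by rewrite addrA [y * y + _]addrC xxyy rmorphB scalerBl scale1r.
Qed.

(** * The norm of a selfadjoint element lies in its spectrum up to sign *)

(** If 1 - x^2 had an inverse, so would 1 - y^2 with y = t x, for t < 1 close to
    1, and with a bound M on the inverse of w = sqrt (1 - y^2) that does not
    depend on t. Then w^2 + y^2 = 1 forces t^2 = |y|^2 <= 1 - 1/M^2, which is
    false once t is close enough to 1. *)
Lemma rnorm1_nonunit x : selfadjoint x -> rnorm x = 1 ->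
  1 - x * x \isn't a GRing.unit.
Proof.
move=> sx x1; apply/negP => ux; pose I := (1 - x * x)^-1; pose N := rnorm I.
have N0 : 0 <= N by exact: rnorm_ge0.
pose M := N *+ 2 + 1; have M0 : 1 <= M by rewrite lerDr mulrn_wge0.
(* With this d, t ^+ 2 > 1 - 2 * d > 1 - M ^- 2, while the inverse of
   1 - y * y has at most twice the norm N of I, because d *+ 2 * N <= 2^-1. *)
pose d := (M ^+ 2 * 4)^-1; pose t := 1 - d.
have Md : M ^+ 2 * 4 * d = 1 by rewrite mulfV// lt0r_neq0//; nra.
have d0 : 0 < d by rewrite invr_gt0; nra.
have d1 : d <= 4^-1 by rewrite lef_pV2 ?posrE//; nra.
pose y : A := t%:C *: x; have sy : selfadjoint y by exact: selfadjointZ.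
have ny : rnorm y = t by rewrite rnormZ x1 mulr1 ger0_norm// /t; lra.
have yy1 : rnorm (y * y) < 1 by rewrite rnorm_sq// ny /t; nra.
have syy : selfadjoint (y * y) by exact: selfadjointM.
have [w [sw ww wc]] := sqrt_1B syy yy1.
have wy : GRing.comm w y by apply/esym/wc/commrM.
have uyy := unit_1B yy1.
have uw : w \is a GRing.unit by have := uyy; rewrite -ww unitrM_comm// andbb.
have IE : (1 - y * y)^-1 - I = (1 - y * y)^-1 * (y * y - x * x) * I.
  have -> : y * y - x * x = (1 - x * x) - (1 - y * y).
    by rewrite opprB [RHS]addrC addrA subrK.
  by rewrite mulrBr mulVr// mulrBl mul1r mulrK.
have yx : rnorm (y * y - x * x) <= d *+ 2.
  rewrite -scalerAl -scalerAr scalerA -{2}[x * x]scale1r -scalerBl -rmorphM.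
  rewrite -(rmorph1 (real_complex R)) -rmorphB/= rnormZ rnorm_sq// x1 expr1n mulr1.
  rewrite ler0_norm /t; nra.
have wN : rnorm w^-1 ^+ 2 <= N *+ 2.
  rewrite -rnorm_sq; last exact: selfadjointV.
  rewrite -invrM// ww; have := rnormD ((1 - y * y)^-1 - I) I; rewrite subrK IE.
  have := rnormM ((1 - y * y)^-1 * (y * y - x * x)) I.
  have := rnormM (1 - y * y)^-1 (y * y - x * x).
  have := rnorm_ge0 (1 - y * y)^-1; have := rnorm_ge0 (y * y - x * x).
  rewrite -/N; set J := rnorm (1 - _)^-1; set D := rnorm (_ - _).
  move=> D0 J0 h1 h2 h3.
  have DN : D * N <= 2^-1.
    rewrite (le_trans (ler_wpM2r N0 yx))//.
    have : 2 * N <= M ^+ 2 by rewrite /M; nra.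
    nra.
  have := ler_wpM2r N0 h1; have := ler_wpM2l J0 DN; lra.
have wM : rnorm w^-1 < M.
  by rewrite -ltr_sqr ?nnegrE ?rnorm_ge0 ?(le_trans ler01)// (le_lt_trans wN)// /M; nra.
have wwyy : w * w + y * y = 1 by rewrite ww subrK.
have := rnorm_le_of_inverse sw sy wy wwyy uw (lt_le_trans ltr01 M0) wM.
have -> : M ^- 2 = 4 * d by rewrite /d; field; apply: lt0r_neq0; exact: lt_le_trans ltr01 M0.
rewrite ny /t; nra.
Qed.

(** After rescaling to norm 1, the product of the two elements is 1 - x^2. *)
Lemma rnorm_in_spectrum x : selfadjoint x -> x != 0 ->
  (rnorm x)%:C%:A - x \is a GRing.unit ->
  (rnorm x)%:C%:A + x \isn't a GRing.unit.
Proof.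
rewrite -rnorm_gt0; set r := rnorm x => sx r0 um; apply/negP => up.
have rC : r%:C * (r^-1)%:C = 1 by rewrite -rmorphM/= divff ?lt0r_neq0.
have rV : (r^-1)%:C \is a GRing.unit.
  by apply/unitrP; exists r%:C; rewrite [in X in _ /\ X]mulrC.
pose X := (r^-1)%:C *: x; have sX : selfadjoint X by exact: selfadjointZ.
have X1 : rnorm X = 1 by rewrite rnormZ gtr0_norm ?invr_gt0// mulVf ?lt0r_neq0.
have/negP := rnorm1_nonunit sX X1; apply.
have -> : 1 - X * X = (1 - X) * (1 + X).
  by rewrite mulrDr mulr1 mulrBl mul1r addrA subrK.
have XE (s : A) : 1 + (r^-1)%:C *: s = (r^-1)%:C *: (r%:C%:A + s).
  by rewrite scalerDr scalerA mulrC rC scale1r.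
have cX : GRing.comm (1 - X) (1 + X).
  apply: commrD; first exact: commr1.
  by apply/commr_sym/commrB; first exact: commr1.
by rewrite unitrM_comm// /X -scalerN !XE !scaler_unit// um.
Qed.

(** Similar elements have the same spectrum, which is bounded by the norm of
    each of them, and for g selfadjoint this bound is reached. *)
Lemma rnorm_le_of_conjugate g (c : A) : selfadjoint g -> c \is a GRing.unit ->
  rnorm g <= rnorm (c * g / c).
Proof.
move=> sg uc; rewrite leNgt; apply/negP => lt.
set r := rnorm g in lt.
have r0 : 0 < r by rewrite (le_lt_trans (rnorm_ge0 _) lt).
have conj (e : A) : c * (r%:C%:A - e) / c = r%:C%:A - c * e / c.
  by rewrite mulrBr mulrBl -scalerAr mulr1 -scalerAl divrr.
have up (e : A) : rnorm e = rnorm (c * g / c) -> r%:C%:A - e \is a GRing.unit.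
  by move=> eE; apply: unit_scalarB; rewrite eE.
have um : r%:C%:A - g \is a GRing.unit.
  by have := up _ erefl; rewrite -conj unitrMl ?unitrV// unitrMr.
have uq : r%:C%:A + g \is a GRing.unit.
  have := up _ (rnormN _); rewrite -[- (c * g / c)]mulNr -[- (c * g)]mulrN -conj opprK.
  by rewrite unitrMl ?unitrV// unitrMr.
have g0 : g != 0 by rewrite -rnorm_gt0.
by have := rnorm_in_spectrum sg g0 um; rewrite uq.
Qed.

(** * Square roots of positive invertible elements *)

(** With s = |a| and b = s - a, the claim is |b| < s, for then a / s = 1 - b / s
    has a square root. Up to sign, |b| is in the spectrum of b: so s + |b| or
    s - |b| is in that of a. The first exceeds |a|; hence s - |b| is
    nonnegative, as a is positive, and nonzero, as a is invertible. *)
Lemma pos_invertible_sqrt (a : A) : pos_invertibles A a ->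
  exists2 c : A, selfadjoint c & c * c = a.
Proof.
move=> [ua [sa pa]]; set s := rnorm a; pose b : A := s%:C%:A - a.
have s0 : 0 < s.
  by rewrite rnorm_gt0; apply: contraTneq ua => ->; rewrite unitr0.
have sb : selfadjoint b by apply: selfadjointB => //; exact: selfadjoint_scalar.
have bs : rnorm b < s.
  have [->|b0] := eqVneq b 0; first by rewrite rnorm0.
  have r0 : 0 < rnorm b by rewrite rnorm_gt0.
  have up : (rnorm b)%:C%:A + b \is a GRing.unit.
    rewrite addrA -scalerDl -rmorphD/=; apply: unit_scalarB.
    by rewrite -/s ltrDr.
  have um : (rnorm b)%:C%:A - b \isn't a GRing.unit.
    by apply: contraL up; exact: rnorm_in_spectrum.
  have um' : (s - rnorm b)%:C%:A - a \isn't a GRing.unit.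
    have -> : (s - rnorm b)%:C%:A - a = - ((rnorm b)%:C%:A - b).
      by rewrite rmorphB scalerBl opprB /b addrAC.
    by rewrite unitrN.
  have := pa _ um'; rewrite ler0c subr_ge0 le_eqVlt => /orP[/eqP bsE|//].
  by move: um'; rewrite bsE subrr scale0r sub0r unitrN ua.
have sV : s * s^-1 = 1 by rewrite divff ?lt0r_neq0.
have [||y [sy yy _]] := @sqrt_1B ((s^-1)%:C *: b); first exact: selfadjointZ.
  by rewrite rnormZ gtr0_norm ?invr_gt0// mulrC ltr_pdivrMr// mul1r.
exists ((Num.sqrt s)%:C *: y); first exact: selfadjointZ.
rewrite -scalerAl -scalerAr scalerA -rmorphM/= -expr2 sqr_sqrtr ?ltW// yy.
by rewrite scalerBr scalerA -rmorphM/= sV scale1r /b opprB addrC subrK.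
Qed.

(** * Selfadjoint elements that are unitary for a twisted involution *)

(** For t < 1 put x = t g and y^2 = 1 - x^2. As |x^-1| <= 1/t < 1/t^2, the
    estimate on the circle x^2 + y^2 = 1 gives |1 - t^2 g^2| <= 1 - t^4, and the
    right side tends to 0 as t tends to 1. *)
Lemma involution_of_contractions g : selfadjoint g -> g \is a GRing.unit ->
  rnorm g <= 1 -> rnorm g^-1 <= 1 -> g * g = 1.
Proof.
move=> sg ug g1 gV1; set D := rnorm (1 - g * g).
have sgg : rnorm (g * g) <= 1 by rewrite rnorm_sq// expr_le1// rnorm_ge0.
have D0 : 0 <= D by exact: rnorm_ge0.
have D2 : D <= 2.
  by have := rnormB 1 (g * g); rewrite rnorm1 -/D; lra.
suff : D <= 0.
  by move=> D0'; apply/esym/subr0_eq/rnorm_eq0/le_anti; rewrite D0' D0.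
rewrite leNgt; apply/negP => D0'.
(* The estimate gives D <= 6 * d for this choice of t, whence a contradiction
   with D = 16 * d. *)
pose d := D / 16; pose t := 1 - d.
have t0 : 0 < t by rewrite /t /d; lra.
have t1 : t < 1 by rewrite /t /d; lra.
pose x : A := t%:C *: g; have sx : selfadjoint x by exact: selfadjointZ.
have tu : t%:C \is a GRing.unit.
  by apply/unitrP; exists (t^-1)%:C; rewrite -!rmorphM/= mulVf ?divff ?lt0r_neq0.
have ux : x \is a GRing.unit by rewrite scaler_unit.
have xx : x * x = (t ^+ 2)%:C *: (g * g).
  by rewrite -scalerAl -scalerAr scalerA -rmorphM.
have tt1 : t ^+ 2 < 1 by rewrite expr_lt1// ltW.
have tt0 : 0 < t ^+ 2 by rewrite exprn_gt0.
have [||y [sy yy yc]] := @sqrt_1B (x * x).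
- exact: selfadjointM.
- rewrite xx rnormZ gtr0_norm//; nra.
have xy : GRing.comm x y by apply/yc/commrM.
have xV : rnorm x^-1 < t ^- 2.
  rewrite invrZ// -fmorphV rnormZ gtr0_norm ?invr_gt0//.
  rewrite (@le_lt_trans _ _ t^-1)//; first by rewrite ler_piMr// invr_ge0 ltW.
  by rewrite ltf_pV2 ?posrE//; nra.
have := @rnorm_le_of_inverse x y (t ^- 2) sx sy xy _ ux _ xV.
rewrite yy addrC subrK invr_gt0 => /(_ erefl tt0).
rewrite -rnorm_sq// yy xx exprVn invrK => H.
have : D <= 1 - (t ^+ 2) ^+ 2 + (1 - t ^+ 2).
  have -> : D = rnorm ((1 - (t ^+ 2)%:C *: (g * g)) - (1 - t ^+ 2)%:C *: (g * g)).
    by rewrite rmorphB scalerBl scale1r opprB addrA subrK.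
  rewrite (le_trans (rnormB _ _))// lerD// rnormZ ger0_norm; last lra.
  by rewrite ler_piMr//; lra.
have Dd : D = d * 16 by rewrite /d; field.
have Td : 1 - t ^+ 2 <= 2 * d by rewrite /t; have := sqr_ge0 d; nra.
have TT : 1 - (t ^+ 2) ^+ 2 <= 2 * (1 - t ^+ 2).
  by have := sqr_ge0 (1 - t ^+ 2); nra.
lra.
Qed.

(** With a = c^2, conjugation by c turns the involution twisted by a into the
    original one, so that w = c g c^-1 is unitary. *)
Lemma unitary_at_selfadjoint (a g : A) : pos_invertibles A a ->
  g \is a GRing.unit -> selfadjoint g -> a^-1 * g * a = g^-1 ->
  g * g = 1 /\ a * g = g * a.
Proof.
move=> pa ug sg ag; have ua : a \is a GRing.unit := pa.1.
have [c sc cc] := pos_invertible_sqrt pa.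
have uc : c \is a GRing.unit by move: ua; rewrite -cc unitrM_comm// andbb.
have gag : g * a * g = a.
  by rewrite -[RHS]mulr1 -(mulVr ug) -ag !mulrA divrr// mul1r.
pose w := c * g / c; have uw : w \is a GRing.unit.
  by rewrite unitrMl ?unitrV// unitrMr.
have ww : star w * w = 1.
  rewrite !starM starV// sc sg /w !mulrA.
  rewrite -[c^-1 * g * c * c]mulrA cc -(mulrA _ g a) -(mulrA _ _ g) gag -cc.
  by rewrite !mulrA mulVr// mul1r divrr.
have w1 : rnorm w = 1.
  by apply/eqP; rewrite -(@eqrXn2 _ 2) ?rnorm_ge0// expr1n -rnorm_starM ww rnorm1.
have wV : w^-1 = star w by rewrite -[RHS](mulrK uw) ww mul1r.
have gg : g * g = 1.
  apply: involution_of_contractions => //; rewrite -w1 ?rnorm_le_of_conjugate//.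
  have <- : rnorm w^-1 = rnorm w by rewrite wV rnorm_star.
  have -> : w^-1 = c * g^-1 / c.
    by rewrite /w invrM ?unitrMr ?unitrV// invrK invrM// mulrA.
  by apply: rnorm_le_of_conjugate => //; exact: selfadjointV.
split=> //.
by rewrite -{1}gag -mulrA gg mulr1.
Qed.

End CStarTheory.

(** * The theorem *)

(** This form of the definition involves no inverse, so it passes between an
    algebra and a subalgebra without a comparison of invertibility. *)
Lemma reflection_sq (R : realType) (B : cstarAlgType R) (u : B) :
  reflections B u <-> selfadjoint u /\ u * u = 1.
Proof.
split=> [[uu [us sV]]|[su uu]].
  by split; [exact: esym | rewrite {2}us sV divrr].
have uu' : u \is a GRing.unit by apply/unitrP; exists u.
by split=> //; split; [exact: esym | rewrite su -[RHS]mul1r -uu mulrK].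
Qed.

Theorem theorem4p1 (R : realType) (A : cstarAlgType R) (a : A)
    (ha : pos_invertibles A a) :
  unitaries_at a `&` sa_invertibles A = val @` reflections (commutant ha) /\
  val @` reflections (commutant ha) =
    [set u | reflections A u /\ a * u = u * a].
Proof.
have commutantE : val @` reflections (commutant ha) =
    [set u | reflections A u /\ a * u = u * a].
  apply/seteqP; split=> [_ [r /reflection_sq[sr rr] <-]|u [/reflection_sq[su uu] au]]/=.
    split; last exact/esym/commutes_withP/(valP r).
    by apply/reflection_sq; split; [exact: (congr1 val sr) | exact: (congr1 val rr)].
  have cu : u \in commutes_with a by apply/commutes_withP.
  by exists (Commutant ha cu) => //; apply/reflection_sq; split; exact: val_inj.
split=> //; rewrite commutantE; apply/seteqP; split=> g /=.
  move=> [[ug gg] [_ sg]]; rewrite sg in gg.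
  have [gg1 ag] := unitary_at_selfadjoint ha ug sg gg.
  by split=> //; apply/reflection_sq.
move=> [[ug [gs sV]] ag]; split; split=> //.
by rewrite sV -mulrA -(commrV (ag : GRing.comm a g)) mulKr//; exact: ha.1.
Qed.
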